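(* Let $p\in[1,2]$ and let $(X,\|\cdot\|_X)$ be a Banach space with Rademacher type $p$. Then there exist a universal constant $C<\infty$ and a constant $C_X<\infty$ depending only on $p$ and $T_p(X)$ such that for every integer $n\ge 2$ there exists an integer $m$ divisible by $4$ with $m\le C\, n^{2-1/p}\log n$ such that for every function $f:\mathbb{Z}_m^n\to X$, \[ \mathbb{E}_{x,\varepsilon}\Big[\big\|f\big(x+\tfrac m2\varepsilon\big)-f(x)\big\|_X^p\Big]\le C_X\, m^p\sum_{j=1}^n \mathbb{E}_x\Big[\|f(x+e_j)-f(x)\|_X^p\Big], \] where $x$ is uniformly distributed on $\mathbb{Z}_m^n$, $\varepsilon$ is uniformly distributed on $\{-1,1\}^n$ (independent of $x$), $x+\frac m2\varepsilon$ is computed in $\mathbb{Z}_m^n$, and $e_1,\dots,e_n$ is the standard basis of $\mathbb{Z}_m^n$.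
   Context: A Banach space $X$ has Rademacher type $p\ge1$ if there is $T<\infty$ such that for every $n\in\mathbb{N}$ and all $x_1,\dots,x_n\in X$, $\mathbb{E}_\varepsilon\|\sum_{j=1}^n\varepsilon_jx_j\|_X^p\le T^p\sum_{j=1}^n\|x_j\|_X^p$, the expectation being over uniform $\varepsilon\in\{-1,1\}^n$; the smallest such $T$ is denoted $T_p(X)$. *)

(* Defs.v *)
From HB Require Import structures.
From mathcomp Require Import all_boot all_order all_algebra.
From mathcomp Require Import all_classical all_reals all_analysis.
Set Implicit Arguments. Unset Strict Implicit. Unset Printing Implicit Defensive.
Import Order.TTheory GRing.Theory Num.Theory.
Import numFieldNormedType.Exports.
Local Open Scope classical_set_scope.
Local Open Scope ring_scope.

Definition sgn {R : ringType} (b : bool) : R := if b then 1 else -1.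

Definition rad_type_consts (R : realType) (X : normedModType R) (p : R) : set R :=
  [set T | 0 <= T /\
    forall (n : nat) (x : 'I_n -> X),
      (#|{ffun 'I_n -> bool}|%:R)^-1 *
        \sum_(eps : {ffun 'I_n -> bool}) `|\sum_(j < n) sgn (eps j) *: x j| `^ p
      <= T `^ p * \sum_(j < n) `|x j| `^ p].

Definition has_rad_type (R : realType) (X : normedModType R) (p : R) : Prop :=
  rad_type_consts X p !=set0.

Definition Tp (R : realType) (X : normedModType R) (p : R) : R :=
  inf (rad_type_consts X p).

Definition avg (R : realType) (T : finType) (F : T -> R) : R :=
  (#|T|%:R)^-1 * \sum_(t : T) F t.

Definition basis_e (m n : nat) (j : 'I_n) : {ffun 'I_n -> 'Z_m} :=
  [ffun i => if i == j then 1 else 0].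

Definition half_shift (m n : nat) (eps : {ffun 'I_n -> bool}) : {ffun 'I_n -> 'Z_m} :=
  [ffun i => (m %/ 2)%:R * sgn (eps i)].

(* Main.v *)
(* One can always take m = 4.  The point is that Rademacher type p implies Enflo type p (Ivanisvili, van Handel, Volberg): for h : {-1,1}^n -> X,
     E |h(e) - h(-e)|^p <= 64 T^p sum_j E |h(e) - h(flip_j e)|^p.
   Let d have independent coordinates with common mean r.  As r runs from -1 to 1, E_d h(d e) runs from h(-e) to h(e), and integrating by parts its r-derivative is
     (1/2) E_d sum_j (d_j - r) / (1 - r^2) (h(d e) - h(flip_j (d e))).
   The coefficients are independent and centered, so after averaging over e the symmetrized type inequality applies.  Their variance 1 / (1 - r^2) is compensated by the parametrization r = (3u - u^3)/2, |u| <= 1.  The integral over u is replaced by a Riemann sum, so that only finite sums in X are needed.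
   Applying this to e |-> f(x + e) on Z_4^n and averaging over x gives the theorem, because 2 e_j = - 2 e_j in Z_4. *)
Require Import Defs.
From HB Require Import structures.
From mathcomp Require Import all_boot all_order all_algebra.
From mathcomp Require Import all_classical all_reals all_analysis.
From mathcomp Require Import ring lra.
Set Implicit Arguments. Unset Strict Implicit. Unset Printing Implicit Defensive.
Import Order.TTheory GRing.Theory Num.Theory.
Import numFieldNormedType.Exports.
Local Open Scope ring_scope.

(** * Jensen's inequality and elementary bounds for p-th powers *)

Lemma powR_convex2 (R : realType) (p t x y : R) :
  1 <= p -> 0 <= t <= 1 -> 0 <= x -> 0 <= y ->
  (t * x + (1 - t) * y) `^ p <= t * x `^ p + (1 - t) * y `^ p.
Proof.
move=> p1 /andP[t0 t1] x0 y0.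
have t01 : Itv.spec (@Itv.num_sem R)
    (Itv.Real (Interval (BLeft 0%Z) (BRight 1%Z))) t.
  by apply/andP; split; [exact: ger0_real|rewrite /= in_itv /= t0 t1].
have mem (z : R) : 0 <= z -> z \in (`[0, +oo[%classic : set R).
  by move=> z0; rewrite inE /= in_itv /= z0.
have := @convex_powR R p p1 (Itv.mk t01) x y (mem _ x0) (mem _ y0).
by rewrite !convRE.
Qed.

Lemma jensen_powR (R : realType) (p : R) (I : finType) (w a : I -> R) :
  1 <= p -> (forall i, 0 <= w i) -> \sum_i w i = 1 -> (forall i, 0 <= a i) ->
  (\sum_i w i * a i) `^ p <= \sum_i w i * a i `^ p.
Proof.
move=> p1 w0 w1 a0.
have p_neq0 : p != 0 by rewrite gt_eqF// (lt_le_trans _ p1).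
(* Dividing by the weight of the sublist makes the claim inductive: each new element is one use of
   two-point convexity. *)
suff H (s : seq I) : 0 < \sum_(i <- s) w i ->
    ((\sum_(i <- s) w i * a i) / (\sum_(i <- s) w i)) `^ p <=
    (\sum_(i <- s) w i * a i `^ p) / (\sum_(i <- s) w i).
  by have := H (index_enum I); rewrite w1 !divr1; apply.
elim: s => [|i s IH]; first by rewrite big_nil ltxx.
rewrite !big_cons.
set A := \sum_(j <- s) w j * a j; set B := \sum_(j <- s) w j * _ `^ p.
have A0 : 0 <= A by apply: sumr_ge0 => j _; rewrite mulr_ge0.
have : 0 <= \sum_(j <- s) w j by apply: sumr_ge0.
move: IH; rewrite -/A -/B; set W := \sum_(j <- s) w j => IH.
(* If the tail has weight 0, all its weights vanish and only the head [i] contributes. *)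
rewrite le_eqVlt => /predU1P[W0|W_gt0] wW.
  have s0 : forall (g : I -> R), \sum_(j <- s) w j * g j = 0.
    move=> g; rewrite big_seq big1// => j js.
    suff -> : w j = 0 by rewrite mul0r.
    apply/eqP; rewrite eq_le w0 andbT W0 /W (big_rem j js)/= lerDl.
    exact: sumr_ge0.
  rewrite /A /B !s0 -W0 !addr0; rewrite -W0 addr0 in wW.
  by rewrite ![w i * _]mulrC !mulfK// gt_eqF.
have {}IH := IH W_gt0.
set V := w i + W in wW *.
have eqn (x y : R) : (w i * x + y) / V = (w i / V) * x + (1 - w i / V) * (y / W).
  by rewrite /V; field; rewrite !gt_eqF.
have t01 : 0 <= w i / V <= 1.
  by rewrite divr_ge0 ?(ltW wW)//= ler_pdivrMr// mul1r lerDl ltW.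
rewrite !eqn; apply: (le_trans (powR_convex2 _ _ _ _)) => //.
  by rewrite divr_ge0// ltW.
by rewrite lerD2l ler_wpM2l// subr_ge0; case/andP: t01.
Qed.

Lemma jensen_norm_powR (R : realType) (X : normedModType R) (p : R) (I : finType)
    (w : I -> R) (v : I -> X) :
  1 <= p -> (forall i, 0 <= w i) -> \sum_i w i = 1 ->
  `|\sum_i w i *: v i| `^ p <= \sum_i w i * `|v i| `^ p.
Proof.
move=> p1 w0 w1.
apply: le_trans (@jensen_powR R p I w (fun i => `|v i|) p1 w0 w1 _); last by [].
rewrite ge0_ler_powR ?nnegrE//; first exact: le_trans p1.
  by apply: sumr_ge0 => i _; rewrite mulr_ge0.
apply: (le_trans (ler_norm_sum _ _ _)); apply: ler_sum => i _.
by rewrite normrZ ger0_norm.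
Qed.

(** Lets a variance control the p-th moment with a bound that does not depend on p. *)
Lemma powR_le_sqr (R : realType) (p x : R) : 1 <= p <= 2 -> 0 <= x ->
  x `^ p <= 1 + x ^+ 2.
Proof.
move=> /andP[p1 p2] x0; have [x1|x1] := leP x 1.
  rewrite -[leLHS]addr0 lerD ?sqr_ge0//.
  apply: (@le_trans _ _ (1 `^ p)); last by rewrite powR1.
  by rewrite ge0_ler_powR ?nnegrE//; exact: le_trans p1.
rewrite -powR_mulrn// -[leLHS]add0r lerD// ler_powR//; exact: ltW.
Qed.

(** Convexity at the midpoint gives the factor 2^p / 2, which is at most 2 because p <= 2. *)
Lemma powR_add_le (R : realType) (p a b : R) : 1 <= p <= 2 -> 0 <= a -> 0 <= b ->
  (a + b) `^ p <= 2 * (a `^ p + b `^ p).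
Proof.
move=> /andP[p1 p2] a0 b0.
have -> : a + b = 2 * (2^-1 * a + (1 - 2^-1) * b) by field.
have h0 : 0 <= 2^-1 :> R by rewrite invr_ge0.
have h1 : 0 <= 1 - 2^-1 :> R by lra.
rewrite powRM ?addr_ge0 ?mulr_ge0//.
have H : (2^-1 * a + (1 - 2^-1) * b) `^ p <= 2^-1 * a `^ p + (1 - 2^-1) * b `^ p.
  by apply: powR_convex2 => //; lra.
apply: (@le_trans _ _ (2 ^+ 2 * (2^-1 * a `^ p + (1 - 2^-1) * b `^ p))); last by lra.
by apply: ler_pM; rewrite ?powR_ge0// -powR_mulrn// ler_powR// ler1n.
Qed.

Lemma norm_add_powR_le (R : realType) (X : normedModType R) (p : R) (x y : X) :
  1 <= p <= 2 -> `|x + y| `^ p <= 2 * (`|x| `^ p + `|y| `^ p).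
Proof.
move=> p12; apply: le_trans (powR_add_le _ _ _) => //.
case/andP: p12 => p1 _.
by rewrite ge0_ler_powR ?nnegrE ?addr_ge0 ?ler_normD//; exact: le_trans p1.
Qed.

(** * Product measures and the symmetrized type inequality *)

Section ProductMeasure.
Variables (R : realType) (n : nat) (B : finType) (mu : B -> R).
Hypotheses (mu_ge0 : forall b, 0 <= mu b) (mu_sum1 : \sum_b mu b = 1).

Let P (a : {ffun 'I_n -> B}) : R := \prod_i mu (a i).

Lemma prod_mass_ge0 a : 0 <= P a.
Proof. by apply: prodr_ge0. Qed.

Lemma prod_mass_marginal (j : 'I_n) (g : B -> R) :
  \sum_a P a * g (a j) = \sum_b mu b * g b.
Proof.
(* Every factor with [i != j] has total mass 1, so the marginal is a product of sums, to which
   distributivity applies. *)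
have -> : \sum_b mu b * g b =
    \prod_i \sum_b (mu b * (if i == j then g b else 1)).
  rewrite (bigD1 j)//= eqxx [X in _ = _ * X]big1 => [|i /negbTE ->].
    by rewrite mulr1.
  by rewrite -mulr_suml mu_sum1 mul1r.
rewrite bigA_distr_bigA; apply: eq_bigr => a _.
rewrite big_split/=; congr (_ * _).
by rewrite (bigD1 j)//= eqxx big1 ?mulr1// => i /negbTE ->.
Qed.

Lemma prod_mass_sum1 : \sum_a P a = 1.
Proof.
rewrite /P -(bigA_distr_bigA (fun=> mu)) big1// => i _; exact: mu_sum1.
Qed.

(* Symmetrization: subtract an independent copy (Jensen), then swap coordinates of the two copies at random. *)
Lemma rad_type_centered (X : normedModType R) (p T : R) (W : B -> R)
    (x : 'I_n -> X) :
  1 <= p <= 2 -> rad_type_consts X p T -> \sum_b mu b * W b = 0 ->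
  \sum_a P a * `|\sum_j W (a j) *: x j| `^ p <=
  4 * T `^ p * (\sum_b mu b * `|W b| `^ p) * \sum_j `|x j| `^ p.
Proof.
move=> p12 [T0 typeT] W0; have /andP[p1 p2] := p12.
pose D (q : {ffun 'I_n -> B} * {ffun 'I_n -> B}) j := W (q.1 j) - W (q.2 j).
pose N q := `|\sum_j D q j *: x j| `^ p.
pose PP (q : {ffun 'I_n -> B} * {ffun 'I_n -> B}) := P q.1 * P q.2.
have PP0 q : 0 <= PP q by rewrite mulr_ge0 ?prod_mass_ge0.
have decouple : \sum_a P a * `|\sum_j W (a j) *: x j| `^ p <= \sum_q PP q * N q.
  rewrite -(pair_bigA _ (fun a a' => P a * P a' * N (a, a')))/=.
  apply: ler_sum => a _.
  under [leRHS]eq_bigr do rewrite -mulrA.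
  rewrite -mulr_sumr ler_wpM2l ?prod_mass_ge0//.
  have -> : \sum_j W (a j) *: x j = \sum_a' P a' *: \sum_j D (a, a') j *: x j.
    under [RHS]eq_bigr do rewrite scaler_sumr.
    rewrite exchange_big/=; apply: eq_bigr => j _.
    under eq_bigr do rewrite scalerA.
    rewrite -scaler_suml; congr (_ *: _).
    rewrite /D/=; under eq_bigr do rewrite mulrBr.
    by rewrite sumrB prod_mass_marginal W0 subr0 -mulr_suml prod_mass_sum1 mul1r.
  by apply: jensen_norm_powR => //; [exact: prod_mass_ge0|exact: prod_mass_sum1].
apply: (le_trans decouple).
pose Ns (s : {ffun 'I_n -> bool}) q := `|\sum_j sgn (s j) *: (D q j *: x j)| `^ p.
have swapE s : \sum_q PP q * N q = \sum_q PP q * Ns s q.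
  pose sw (q : {ffun 'I_n -> B} * {ffun 'I_n -> B}) :=
    ([ffun i => if s i then q.1 i else q.2 i],
     [ffun i => if s i then q.2 i else q.1 i]).
  have swK : involutive sw.
    move=> [a a']; congr pair; apply/ffunP => i; rewrite !ffunE/= ?ffunE;
      by case: (s i).
  rewrite (reindex_inj (inv_inj swK))/=; apply: eq_bigr => q _; congr (_ * _).
    rewrite /PP /P -!big_split; apply: eq_bigr => i _ /=; rewrite !ffunE.
    by case: (s i) => //; rewrite mulrC.
  rewrite /N /Ns; congr (`|_| `^ _); apply: eq_bigr => j _.
  rewrite /D !ffunE scalerA; congr (_ *: _); rewrite /sgn.
  by case: (s j); rewrite ?mul1r ?mulN1r ?opprB.
set K := #|{ffun 'I_n -> bool}|%:R : R.
have K0 : K != 0 by rewrite pnatr_eq0 card_ffun card_bool card_ord -lt0n expn_gt0.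
have -> : \sum_q PP q * N q = \sum_q PP q * (K^-1 * \sum_s Ns s q).
  transitivity (K^-1 * \sum_(s : {ffun 'I_n -> bool}) \sum_q PP q * Ns s q).
    under [X in _ = _ * X]eq_bigr do rewrite -swapE.
    by rewrite sumr_const -[_ *+ _]mulr_natl mulKf.
  rewrite exchange_big/= mulr_sumr; apply: eq_bigr => q _.
  by rewrite -mulr_sumr mulrCA.
apply: (@le_trans _ _ (\sum_q PP q * (T `^ p * \sum_j `|D q j *: x j| `^ p))).
  by apply: ler_sum => q _; rewrite ler_wpM2l//; exact: typeT.
have -> : \sum_q PP q * (T `^ p * \sum_j `|D q j *: x j| `^ p) =
    T `^ p * \sum_j (\sum_q PP q * `|D q j| `^ p) * `|x j| `^ p.
  under [X in _ = _ * X]eq_bigr do rewrite mulr_suml.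
  rewrite exchange_big/= mulr_sumr; apply: eq_bigr => q _.
  rewrite mulrCA mulr_sumr; congr (_ * _); apply: eq_bigr => j _.
  by rewrite normrZ powRM// mulrA.
rewrite -!mulrA mulrCA ler_wpM2l ?powR_ge0//.
rewrite mulrA mulr_sumr; apply: ler_sum => j _.
rewrite ler_wpM2r ?powR_ge0//.
set M := \sum_b mu b * `|W b| `^ p.
(* The final constant 4 is this 2 times the two copies, which have equal moments. *)
apply: (@le_trans _ _ (\sum_q PP q * (2 * (`|W (q.1 j)| `^ p + `|W (q.2 j)| `^ p)))).
  apply: ler_sum => q _; rewrite ler_wpM2l// -[`|W (q.2 j)|]normrN.
  exact: (@norm_add_powR_le R R^o).
rewrite -(pair_bigA _ (fun a a' => P a * P a' *
  (2 * (`|W (a j)| `^ p + `|W (a' j)| `^ p))))/=.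
rewrite (_ : 4 * M = \sum_a (P a * (2 * (`|W (a j)| `^ p + M)))).
  apply: ler_sum => a _; under [leLHS]eq_bigr do rewrite -mulrA.
  rewrite -mulr_sumr ler_wpM2l ?prod_mass_ge0//.
  under [leLHS]eq_bigr do rewrite mulrCA mulrDr.
  rewrite -mulr_sumr big_split/= -mulr_suml prod_mass_sum1 mul1r.
  by rewrite (prod_mass_marginal j (fun b => `|W b| `^ p)).
under eq_bigr do rewrite mulrCA mulrDr.
rewrite -mulr_sumr big_split/= -mulr_suml prod_mass_sum1 mul1r.
rewrite (prod_mass_marginal j (fun b => `|W b| `^ p)) -/M; ring.
Qed.

End ProductMeasure.

(** * Polynomial curves in a normed space and Riemann sums *)

(** Induction on the Horner form. The three bounds go together: the Taylor bound for [P * 'X + c]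
    uses the Lipschitz bound for [P], which in turn rests on the uniform bound. *)
Lemma poly_taylor1 (R : realType) (P : {poly R}) :
  exists M : R, forall u v : R, `|u| <= 1 -> `|v| <= 1 ->
  [/\ `|P.[u]| <= M, `|P.[v] - P.[u]| <= M * `|v - u| &
      `|P.[v] - P.[u] - (v - u) * P^`().[u]| <= M * (v - u) ^+ 2].
Proof.
elim/poly_ind: P => [|P c [M IH]].
  by exists 0 => u v _ _; rewrite deriv0 !horner0 subrr mulr0 subrr normr0 !mul0r.
exists (2 * M + `|c|) => u v u1 v1.
have [Pu PL PT] := IH u v u1 v1.
have M0 : 0 <= M by exact: le_trans Pu.
rewrite derivMXaddC !hornerMXaddC hornerD hornerMX.
have E1 : P.[v] * v + c - (P.[u] * u + c) =
    v * (P.[v] - P.[u]) + (v - u) * P.[u] by ring.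
have E2 : P.[v] * v + c - (P.[u] * u + c) - (v - u) * (P.[u] + P^`().[u] * u) =
    u * (P.[v] - P.[u] - (v - u) * P^`().[u]) + (v - u) * (P.[v] - P.[u]) by ring.
split.
- apply: (le_trans (ler_normD _ _)); rewrite lerD2r normrM.
  apply: (@le_trans _ _ (M * 1)); first exact: ler_pM.
  by rewrite mulr1; lra.
- rewrite E1; apply: (le_trans (ler_normD _ _)); rewrite !normrM.
  apply: (@le_trans _ _ (1 * (M * `|v - u|) + `|v - u| * M)).
    by apply: lerD; apply: ler_pM.
  by have := mulr_ge0 (normr_ge0 c) (normr_ge0 (v - u)); lra.
- rewrite E2; apply: (le_trans (ler_normD _ _)); rewrite !normrM.
  apply: (@le_trans _ _ (1 * (M * (v - u) ^+ 2) + `|v - u| * (M * `|v - u|))).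
    by apply: lerD; apply: ler_pM.
  have -> : `|v - u| * (M * `|v - u|) = M * (v - u) ^+ 2.
    by rewrite mulrCA -expr2 -normrX ger0_norm// sqr_ge0.
  have : 0 <= `|c| * (v - u) ^+ 2 by rewrite mulr_ge0// sqr_ge0.
  lra.
Qed.

Lemma deriv_prod (R : comNzRingType) (I : finType) (F : I -> {poly R}) :
  (\prod_i F i)^`() = \sum_j (F j)^`() * \prod_(i | i != j) F i.
Proof.
(* Without repetitions, the filter [i != j] removes exactly one factor. *)
suff H (s : seq I) : uniq s -> (\prod_(i <- s) F i)^`() =
    \sum_(j <- s) (F j)^`() * \prod_(i <- s | i != j) F i.
  exact: H (index_enum_uniq I).
elim: s => [|a s IH]; first by rewrite !big_nil -[1]/(1%:P) derivC.
move=> /= /andP[aNs us]; rewrite !big_cons derivM IH// eqxx/=.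
congr (_ * _ + _).
  rewrite big_seq [RHS]big_seq_cond; apply: eq_bigl => i.
  by case: (boolP (i \in s)) => //= iins; apply/esym; apply: contraNneq aNs => <-.
rewrite mulr_sumr !big_seq; apply: eq_bigr => j js.
have aj : a != j by apply: contraNneq aNs => ->.
by rewrite big_cons aj mulrCA.
Qed.

(** Telescoping over [N.+1] equal steps of [-1,1], with a Taylor bound on each. The factor 2 is the
    length of the interval; the weights sum to 1, ready for Jensen. *)
Lemma poly_curve_length (R : realType) (X : normedModType R) (I : finType)
    (Q : I -> {poly R}) (v : I -> X) :
  exists2 M : R, 0 <= M & forall N : nat,
    `|\sum_i (Q i).[1] *: v i - \sum_i (Q i).[-1] *: v i| <=
    2 * (\sum_(k < N.+1) N.+1%:R^-1 *
      `|\sum_i (Q i)^`().[-1 + k%:R * (2 / N.+1%:R)] *: v i|) + M / N.+1%:R.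
Proof.
have [m mP] := choice (fun i => poly_taylor1 (Q i)).
have n1 : `|1 : R| <= 1 by rewrite normr1.
have m0 i : 0 <= m i.
  by have [+ _ _] := mP i 1 1 n1 n1; exact: le_trans.
(* There are [N.+1] errors, each with factor h^2 = 4 / (N+1)^2, so together they carry the factor 4
   / (N+1). *)
exists (4 * \sum_i m i * `|v i|).
  by rewrite mulr_ge0// sumr_ge0// => i _; rewrite mulr_ge0.
move=> N; set h : R := 2 / N.+1%:R; pose u k : R := -1 + k%:R * h.
have N0 : 0 < N.+1%:R :> R by [].
have h0 : 0 <= h by rewrite divr_ge0.
have uN : u N.+1 = 1 by rewrite /u /h mulrCA divff ?gt_eqF//; lra.
have u1 k : (k <= N.+1)%N -> `|u k| <= 1.
  move=> kN; have : k%:R * h <= N.+1%:R * h by rewrite ler_wpM2r// ler_nat.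
  have : 0 <= k%:R * h by rewrite mulr_ge0.
  have -> : N.+1%:R * h = 2 by rewrite /h mulrCA divff ?gt_eqF// mulr1.
  by rewrite ler_norml /u => ? ?; apply/andP; split; lra.
pose g (x : R) := \sum_i (Q i).[x] *: v i.
pose g' (x : R) := \sum_i (Q i)^`().[x] *: v i.
have -> : \sum_i (Q i).[1] *: v i - \sum_i (Q i).[-1] *: v i =
    \sum_(0 <= k < N.+1) (g (u k.+1) - g (u k)).
  by rewrite telescope_sumr// uN /u mul0r addr0.
have step k : (k < N.+1)%N ->
    `|g (u k.+1) - g (u k)| <= h * `|g' (u k)| + h ^+ 2 * \sum_i m i * `|v i|.
  move=> kN; have uS : u k.+1 - u k = h by rewrite /u -natr1; ring.
  have -> : g (u k.+1) - g (u k) = h *: g' (u k) +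
      \sum_i ((Q i).[u k.+1] - (Q i).[u k] - h * (Q i)^`().[u k]) *: v i.
    rewrite /g /g' scaler_sumr -sumrB -big_split/=; apply: eq_bigr => i _.
    by rewrite scalerA -scalerBl -scalerDl; congr (_ *: _); ring.
  apply: (le_trans (ler_normD _ _)); rewrite normrZ ger0_norm// lerD2l.
  apply: (le_trans (ler_norm_sum _ _ _)); rewrite mulr_sumr; apply: ler_sum => i _.
  rewrite normrZ mulrA [h ^+ 2 * _]mulrC ler_wpM2r//.
  have [_ _] := mP i (u k) (u k.+1) (u1 _ (ltnW kN)) (u1 _ kN).
  by rewrite uS.
rewrite big_mkord; apply: (le_trans (ler_norm_sum _ _ _)).
apply: (le_trans (ler_sum _ (fun (k : 'I_N.+1) _ => step k (ltn_ord k)))).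
rewrite big_split/= sumr_const card_ord -[X in _ + X <= _]mulr_natl; apply: lerD.
  rewrite mulr_sumr; apply: ler_sum => k _; by rewrite [leRHS]mulrA lexx.
rewrite /h le_eqVlt; apply/orP; left; apply/eqP; field; exact: lt0r_neq0.
Qed.

(** Disposes of the discretization error of the Riemann sums. *)
Lemma le_of_le_add_div (R : realType) (a b c : R) :
  (forall N : nat, a <= b + c / N.+1%:R) -> a <= b.
Proof.
move=> H; rewrite leNgt; apply/negP => ba.
have d0 : 0 < a - b by rewrite subr_gt0.
have := H (Num.truncn (`|c| / (a - b))); set N := Num.truncn _.
apply/negP; rewrite -ltNge.
have : `|c| / (a - b) < N.+1%:R by rewrite truncnS_gt.
rewrite ltr_pdivrMr// => H2.
rewrite -ltrBrDl ltr_pdivrMr//.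
by apply: (le_lt_trans (ler_norm c)); rewrite mulrC.
Qed.

(** * Operations on the sign cube *)

(** With [true] standing for the sign 1, the product of two signs is their equality test. *)
Definition cube_mul n (a b : {ffun 'I_n -> bool}) : {ffun 'I_n -> bool} :=
  [ffun i => a i == b i].

Definition cube_flip n (j : 'I_n) (a : {ffun 'I_n -> bool}) : {ffun 'I_n -> bool} :=
  [ffun i => (i == j) (+) a i].

Definition cube_neg n (a : {ffun 'I_n -> bool}) : {ffun 'I_n -> bool} :=
  [ffun i => ~~ a i].

Lemma cube_mulK n (a : {ffun 'I_n -> bool}) : involutive (cube_mul a).
Proof.
by move=> b; apply/ffunP => i; rewrite !ffunE; case: (a i); case: (b i).
Qed.

Lemma cube_flipK n (j : 'I_n) : involutive (cube_flip j).
Proof. by move=> a; apply/ffunP => i; rewrite !ffunE addbA addbb. Qed.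

Lemma cube_mul_flip n (j : 'I_n) (a b : {ffun 'I_n -> bool}) :
  cube_mul (cube_flip j a) b = cube_flip j (cube_mul a b).
Proof.
by apply/ffunP => i; rewrite !ffunE; case: (i == j); case: (a i); case: (b i).
Qed.

(** * Biased signs and their score *)

Section BiasedCurve.
Variable R : realType.
Implicit Types (u : R) (b : bool).

(* [bias u] is the law of a sign with mean [(3u - u^3)/2].  This mean runs from -1 to 1 with a speed so small at the endpoints that the score [score u] has bounded variance there. *)
Definition bias u b : R := (1 + (3 * u - u ^+ 3) / 2 * sgn b) / 2.

Definition bias_poly b : {poly R} :=
  2^-1 *: (1%:P + (2^-1 * sgn b) *: (3 *: 'X - 'X^3)).

(* Half the derivative of the mean times (sign - mean) / variance; it is 0 at [u = 1] and [u = -1] because of division by zero. *)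
Definition score u b : R :=
  3 * (sgn b - (3 * u - u ^+ 3) / 2) / ((1 - u ^+ 2) * (4 - u ^+ 2)).

Lemma horner_bias_poly u b : (bias_poly b).[u] = bias u b.
Proof. by rewrite /bias_poly /bias !hornerE; field. Qed.

Lemma horner_deriv_bias_poly u b :
  (bias_poly b)^`().[u] = sgn b * (3 * (1 - u ^+ 2)) / 4.
Proof.
rewrite /bias_poly derivZ derivD derivC derivZ derivB derivZ derivX derivXn.
by rewrite !hornerE/=; field.
Qed.

Lemma bias_ge0 u b : `|u| <= 1 -> 0 <= bias u b.
Proof.
rewrite ler_norml => /andP[u0 u1].
(* These products are 2 - 3u + u^3 and 2 + 3u - u^3, four times the two values of [bias u]. *)
have H1 : 0 <= (1 - u) ^+ 2 * (2 + u) by rewrite mulr_ge0 ?sqr_ge0//; lra.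
have H2 : 0 <= (1 + u) ^+ 2 * (2 - u) by rewrite mulr_ge0 ?sqr_ge0//; lra.
rewrite /bias /sgn; case: b; lra.
Qed.

Lemma bias_sum1 u : \sum_b bias u b = 1.
Proof. by rewrite big_bool /bias /sgn/=; field. Qed.

Lemma score_mean0 u : \sum_b bias u b * score u b = 0.
Proof. by rewrite big_bool /bias /score /sgn/= !mulrA -mulrDl; ring. Qed.

Lemma four_sub_sqr_neq0 u : `|u| <= 1 -> 4 - u ^+ 2 != 0.
Proof.
move=> u1; have : u ^+ 2 <= 1.
  by rewrite -(ger0_norm (sqr_ge0 u)) normrX expr_le1.
by move=> ?; rewrite gt_eqF//; lra.
Qed.

Lemma score_moment (p : R) u : 1 <= p <= 2 -> `|u| <= 1 ->
  \sum_b bias u b * `|score u b| `^ p <= 2.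
Proof.
move=> p12 u1.
apply: (@le_trans _ _ (\sum_b bias u b * (1 + score u b ^+ 2))).
  apply: ler_sum => b _; rewrite ler_wpM2l ?bias_ge0//.
  by rewrite -(ger0_norm (sqr_ge0 (score u b))) normrX powR_le_sqr.
under eq_bigr do rewrite mulrDr mulr1.
rewrite big_split/= bias_sum1 -[leRHS]/(1 + 1) lerD2l big_bool/=.
have [e|ne] := eqVneq (1 - u ^+ 2) 0.
  by rewrite /score e mul0r invr0 !mulr0 expr0n/= !mulr0 addr0.
have u2 : u ^+ 2 <= 1.
  by rewrite -(ger0_norm (sqr_ge0 u)) normrX expr_le1.
have n4 := four_sub_sqr_neq0 u1.
(* With r the mean, 1 - r^2 = (1 - u^2)^2 (4 - u^2) / 4, so the singular factor cancels from the
   variance of the score, which is at most 3/4. *)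
rewrite (_ : _ + _ = 9 / (4 * (4 - u ^+ 2))); last first.
  by rewrite /score /bias /sgn/=; field; rewrite n4 ne.
by rewrite ler_pdivrMr; lra.
Qed.

(** Integration by parts in one coordinate: the right side is the derivative of [bias_poly b] at
    [u]. It vanishes at the endpoints, in agreement with the default value 0 of [score]. *)
Lemma bias_score u b : `|u| <= 1 ->
  bias u b * score u b - bias u (~~ b) * score u (~~ b) =
  sgn b * (3 * (1 - u ^+ 2)) / 4.
Proof.
move=> u1; have [e|ne] := eqVneq (1 - u ^+ 2) 0.
  by rewrite /score e mul0r invr0 !mulr0 mul0r subrr.
have n4 := four_sub_sqr_neq0 u1.
by rewrite /score /bias /sgn; case: b => /=; field; rewrite n4 ne.
Qed.

End BiasedCurve.

(** * Enflo type on the sign cube *)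

(** For the endpoints of the curve, where the biased product law is a point mass. *)
Lemma sum_prod_indicator (R : realType) (X : normedModType R) n
    (c : {ffun 'I_n -> bool}) (y : {ffun 'I_n -> bool} -> X) :
  \sum_(e : {ffun 'I_n -> bool}) (\prod_i ((e i == c i)%:R : R)) *: y e = y c.
Proof.
rewrite (bigD1 c)//= [X in X *: _]big1 ?scale1r => [|i _]; last by rewrite eqxx.
rewrite big1 ?addr0// => e /eqP ec.
have [i ei] : exists i, e i != c i.
  apply/existsP; apply: contra_notT ec; rewrite negb_exists => /forallP H.
  by apply/ffunP => i; apply/eqP; rewrite -[_ == _]negbK.
by rewrite (bigD1 i)//= (negbTE ei) mul0r scale0r.
Qed.

Section EnfloType.
Variables (R : realType) (X : normedModType R) (n : nat).
Variable h : {ffun 'I_n -> bool} -> X.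
Implicit Types e d : {ffun 'I_n -> bool}.

Let Q d : {poly R} := \prod_i bias_poly R (d i).
Let P (u : R) d : R := \prod_i bias u (d i).
Let D j e : X := h e - h (cube_flip j e).

Lemma biased_curve_right e : \sum_d (Q d).[1] *: h (cube_mul d e) = h e.
Proof.
under eq_bigr => d _.
  rewrite horner_prod; under eq_bigr => i _.
    rewrite horner_bias_poly (_ : bias 1 (d i) = (d i == [ffun=> true] i)%:R).
      over.
    by rewrite ffunE /bias /sgn; case: (d i) => /=; field.
  over.
rewrite (sum_prod_indicator _ (fun d => h (cube_mul d e))).
by congr h; apply/ffunP => i; rewrite !ffunE.
Qed.

Lemma biased_curve_left e : \sum_d (Q d).[-1] *: h (cube_mul d e) = h (cube_neg e).
Proof.
under eq_bigr => d _.
  rewrite horner_prod; under eq_bigr => i _.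
    rewrite horner_bias_poly (_ : bias (-1) (d i) = (d i == [ffun=> false] i)%:R).
      over.
    by rewrite ffunE /bias /sgn; case: (d i) => /=; field.
  over.
rewrite (sum_prod_indicator _ (fun d => h (cube_mul d e))).
by congr h; apply/ffunP => i; rewrite !ffunE.
Qed.

(* Integration by parts on the biased cube: the derivative in the bias is an average of score-weighted discrete derivatives. *)
Lemma biased_curve_deriv u e : `|u| <= 1 ->
  \sum_d (Q d)^`().[u] *: h (cube_mul d e) =
  \sum_d P u d *: \sum_j score u (d j) *: D j (cube_mul d e).
Proof.
move=> u1; under [RHS]eq_bigr do rewrite scaler_sumr.
rewrite [RHS]exchange_big/=.
under [LHS]eq_bigr do rewrite /Q deriv_prod horner_sum scaler_suml.
rewrite exchange_big/=; apply: eq_bigr => j _.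
pose A d := \prod_(i | i != j) bias u (d i).
have PA d : P u d = bias u (d j) * A d by rewrite /P (bigD1 j).
have Aflip d : A (cube_flip j d) = A d.
  by apply: eq_bigr => i /negbTE ij; rewrite ffunE ij.
transitivity (\sum_d (P u d * score u (d j)) *: h (cube_mul d e) -
    \sum_d (P u d * score u (d j)) *: h (cube_mul (cube_flip j d) e)); last first.
  rewrite -sumrB; apply: eq_bigr => d _.
  by rewrite scalerA -scalerBr cube_mul_flip.
(* Reindexing by the flip moves the difference from [h] to the weights; [bias_score] then identifies
   the coefficient. *)
rewrite [X in _ = _ - X](reindex_inj (inv_inj (@cube_flipK n j)))/= -sumrB.
apply: eq_bigr => d _; rewrite cube_flipK -scalerBl; congr (_ *: _).
rewrite !PA Aflip ffunE eqxx /= hornerM horner_deriv_bias_poly -bias_score//.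
rewrite horner_prod (eq_bigr (fun i => bias u (d i))) => [|i _]; last first.
  exact: horner_bias_poly.
by rewrite -/(A d); ring.
Qed.

Lemma biased_curve_deriv_norm (p T u : R) :
  1 <= p <= 2 -> rad_type_consts X p T -> `|u| <= 1 ->
  \sum_e `|\sum_d (Q d)^`().[u] *: h (cube_mul d e)| `^ p <=
  8 * T `^ p * \sum_e \sum_j `|D j e| `^ p.
Proof.
move=> p12 typeT u1; have /andP[p1 _] := p12.
have b0 b : 0 <= bias u b by exact: bias_ge0.
apply: (@le_trans _ _ (\sum_e \sum_d P u d *
    `|\sum_j score u (d j) *: D j (cube_mul d e)| `^ p)).
  apply: ler_sum => e _; rewrite biased_curve_deriv//.
  apply: jensen_norm_powR => // [d|]; first exact: prod_mass_ge0.
  exact: (prod_mass_sum1 n (bias_sum1 u)).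
rewrite exchange_big/=.
under eq_bigr => d _.
  (* Replacing [e] by its product with [d] frees the vectors [D j e] from [d], so for fixed [e] only
     the scores are random. The constant 8 is 4 from symmetrization times 2 from [score_moment]. *)
  rewrite (reindex_inj (inv_inj (@cube_mulK n d)))/=.
  under eq_bigr do rewrite cube_mulK.
  over.
rewrite exchange_big/= mulr_sumr; apply: ler_sum => e _.
have := rad_type_centered (mu := bias u) b0 (bias_sum1 u) (fun j => D j e) p12
  typeT (score_mean0 u).
move=> /le_trans; apply; rewrite ler_wpM2r//.
  by apply: sumr_ge0 => j _; exact: powR_ge0.
have := score_moment p12 u1; have := powR_ge0 T p; nra.
Qed.

Lemma enflo_type_of_rad_type (p T : R) :
  1 <= p <= 2 -> rad_type_consts X p T ->
  \sum_e `|h e - h (cube_neg e)| `^ p <=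
  64 * T `^ p * \sum_e \sum_j `|h e - h (cube_flip j e)| `^ p.
Proof.
move=> p12 typeT; have /andP[p1 p2] := p12.
have p0 : 0 <= p by exact: le_trans p1.
set S := \sum_e \sum_j _.
(* The error constant may depend on [e] but not on [N], so it disappears at the end. *)
have [M MP] := choice (fun e =>
  let: ex_intro2 M M0 MP := poly_curve_length Q (fun d => h (cube_mul d e)) in
  ex_intro (fun M => 0 <= M /\ forall N : nat, _ <= _ + M / N.+1%:R) M (conj M0 MP)).
apply: (@le_of_le_add_div _ _ _ (2 * \sum_e M e `^ p)) => N.
have N0 : 0 < N.+1%:R :> R by [].
pose u (k : 'I_N.+1) : R := -1 + k%:R * (2 / N.+1%:R).
have u1 k : `|u k| <= 1.
  rewrite /u; set x := k%:R * _.
  have x2 : x <= 2.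
    rewrite /x mulrCA ger_pMr// ler_pdivrMr// mul1r ler_nat; exact: ltnW.
  have x0 : 0 <= x by rewrite mulr_ge0.
  by rewrite ler_norml; apply/andP; split; lra.
pose G e k := `|\sum_d (Q d)^`().[u k] *: h (cube_mul d e)|.
(* The 2 comes from [powR_add_le] and the 4 bounds 2^p; with the 8 for the derivative they make
   64. *)
have pointwise e : `|h e - h (cube_neg e)| `^ p <=
    2 * (4 * \sum_k N.+1%:R^-1 * G e k `^ p + M e `^ p / N.+1%:R).
  have [M0 /(_ N)] := MP e; rewrite biased_curve_right biased_curve_left => H.
  have G0 : 0 <= \sum_k N.+1%:R^-1 * G e k 
    by apply: sumr_ge0 => k _; rewrite /G mulr_ge0.
  apply: (@le_trans _ _ ((2 * \sum_k N.+1%:R^-1 * G e k + M e / N.+1%:R) `^ p)).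
    by apply: ge0_ler_powR; rewrite ?nnegrE ?addr_ge0 ?mulr_ge0.
  apply: (le_trans (powR_add_le p12 _ _)); rewrite ?mulr_ge0//.
  rewrite ler_wpM2l// lerD//.
    rewrite powRM//; apply: ler_pM; rewrite ?powR_ge0//.
      by apply: (@le_trans _ _ (2 `^ 2)); [rewrite ler_powR// ler1n|
        rewrite powR_mulrn//; lra].
    apply: jensen_powR => // [|k]; last exact: normr_ge0.
    by rewrite sumr_const card_ord -[_ *+ _]mulr_natl divff// gt_eqF.
  rewrite powRM ?invr_ge0// ler_wpM2l ?powR_ge0// ge1r_powR//.
  by rewrite invr_gt0 N0 invf_le1// ler1n.
apply: (le_trans (ler_sum _ (fun e _ => pointwise e))).
rewrite -mulr_sumr big_split/= -mulr_sumr -mulr_suml mulrDr mulrA; apply: lerD.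
  rewrite exchange_big/=.
  apply: (@le_trans _ _ (2 * 4 * \sum_(k < N.+1) N.+1%:R^-1 * (8 * T `^ p * S))).
    rewrite ler_wpM2l//; apply: ler_sum => k _; rewrite -mulr_sumr ler_wpM2l//.
    exact: biased_curve_deriv_norm.
  rewrite sumr_const card_ord -[X in _ * X]mulr_natl mulVKf ?gt_eqF//.
  by rewrite le_eqVlt; apply/orP; left; apply/eqP; ring.
by rewrite mulrA.
Qed.

End EnfloType.

(** * Transfer from the sign cube to the discrete torus of side 4 *)

Lemma sum_shift (R : realType) (n : nat) (V : finZmodType)
    (F : {ffun 'I_n -> V} -> R) (v : {ffun 'I_n -> V}) :
  \sum_(x : {ffun 'I_n -> V}) F (x + v) = \sum_x F x.
Proof. by rewrite [RHS](reindex_inj (addIr v)). Qed.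

Section ZFour.
Variables (R : realType) (X : normedModType R) (n : nat).

Let signs (e : {ffun 'I_n -> bool}) : {ffun 'I_n -> 'Z_4} := [ffun i => sgn (e i)].

Lemma half_shift4 (e : {ffun 'I_n -> bool}) : half_shift 4 e = signs e + signs e.
Proof.
by apply/ffunP => i; rewrite !ffunE -mulr2n -[RHS]mulr_natl.
Qed.

Lemma signs_neg (e : {ffun 'I_n -> bool}) : signs (cube_neg e) = - signs e.
Proof. by apply/ffunP => i; rewrite !ffunE; case: (e i) => /=; rewrite ?opprK. Qed.

(** As 2 = -2 modulo 4, flipping a sign is translation by the same vector whichever sign is
    flipped. *)
Lemma signs_flip (j : 'I_n) (e : {ffun 'I_n -> bool}) :
  signs e = basis_e 4 j + basis_e 4 j + signs (cube_flip j e).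
Proof.
apply/ffunP => i; rewrite !ffunE; case: eqP => _ /=; last by rewrite !add0r.
by case: (e i); apply/val_inj.
Qed.

Lemma enflo_type_Z4 (p T : R) (f : {ffun 'I_n -> 'Z_4} -> X) :
  1 <= p <= 2 -> rad_type_consts X p T ->
  avg (fun x : {ffun 'I_n -> 'Z_4} => avg (fun e : {ffun 'I_n -> bool} =>
    `|f (x + half_shift 4 e) - f x| `^ p)) <=
  256 * T `^ p * \sum_(j < n) avg (fun x : {ffun 'I_n -> 'Z_4} => `|f (x + basis_e 4 j) - f x| `^ p).
Proof.
move=> p12 typeT; rewrite /avg.
rewrite -[in leRHS]mulr_sumr [leRHS]mulrCA ler_wpM2l ?invr_ge0//.
set B := #|{ffun 'I_n -> bool}|%:R : R.
have B0 : 0 < B by rewrite ltr0n card_ffun card_bool card_ord expn_gt0.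
rewrite -mulr_sumr mulrC ler_pdivrMr//.
pose h (x : {ffun 'I_n -> 'Z_4}) (e : {ffun 'I_n -> bool}) := f (x + signs e).
(* Translating [x] by [signs e] turns the antipodal difference of [h x] into the half shift of
   [f]. *)
have -> : \sum_(x : {ffun 'I_n -> 'Z_4}) \sum_e `|f (x + half_shift 4 e) - f x| `^ p =
    \sum_x \sum_e `|h x e - h x (cube_neg e)| `^ p.
  rewrite exchange_big/= [RHS]exchange_big/=; apply: eq_bigr => e _.
  rewrite -[RHS](sum_shift _ (signs e)); apply: eq_bigr => x _.
  by rewrite /h half_shift4 signs_neg addrA addrK.
apply: (le_trans (ler_sum _ (fun x _ => enflo_type_of_rad_type (h x) p12 typeT))).
rewrite -mulr_sumr (_ : 256 = 64 * 4 :> R); last by ring.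
rewrite -!mulrA ler_wpM2l// [leRHS]mulrCA ler_wpM2l ?powR_ge0//.
under eq_bigr do rewrite exchange_big/=.
rewrite exchange_big/= mulr_suml mulr_sumr; apply: ler_sum => j _.
rewrite exchange_big/=.
set S := \sum_(x : {ffun 'I_n -> 'Z_4}) `|f (x + basis_e 4 j) - f x| `^ p.
have -> : 4 * (S * B) = \sum_(e : {ffun 'I_n -> bool}) 4 * S.
  by rewrite sumr_const -[RHS]mulr_natl -/B; ring.
apply: ler_sum => e _.
have -> : \sum_(x : {ffun 'I_n -> 'Z_4}) `|h x e - h x (cube_flip j e)| `^ p =
    \sum_(x : {ffun 'I_n -> 'Z_4}) `|f (x + basis_e 4 j + basis_e 4 j) - f x| `^ p.
  rewrite -[RHS](sum_shift _ (signs (cube_flip j e))); apply: eq_bigr => x _.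
  rewrite /h (signs_flip j e); congr (`|f _ - _| `^ _).
  by rewrite -!addrA [signs _ + _]addrC !addrA.
(* The step of length 2 splits into two unit steps with equal sums over [x]; [norm_add_powR_le]
   supplies the other factor 2. *)
have -> : 4 * S = 2 * (\sum_(x : {ffun 'I_n -> 'Z_4})
    `|f (x + basis_e 4 j + basis_e 4 j) - f (x + basis_e 4 j)| `^ p + S).
  rewrite (sum_shift (fun x => `|f (x + basis_e 4 j) - f x| `^ p) (basis_e 4 j)).
  by rewrite -/S; ring.
rewrite -big_split mulr_sumr; apply: ler_sum => x _ /=.
rewrite -(subrKA (f (x + basis_e 4 j))); exact: norm_add_powR_le.
Qed.

End ZFour.

Theorem theorem1p2 (R : realType) :
  exists (C : R) (CX : R -> R -> R),
  forall (p : R), 1 <= p <= 2 ->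
  forall (X : completeNormedModType R), has_rad_type X p ->
  forall n : nat, (2 <= n)%N ->
  exists m : nat, (0 < m)%N /\ (4 %| m)%N /\
    m%:R <= C * (n%:R `^ (2 - p^-1)) * ln n%:R /\
    forall f : {ffun 'I_n -> 'Z_m} -> X,
      avg (fun x : {ffun 'I_n -> 'Z_m} =>
             avg (fun eps : {ffun 'I_n -> bool} =>
                    `|f (x + half_shift m eps) - f x| `^ p))
      <= CX p (Tp X p) * m%:R `^ p *
           \sum_(j < n) avg (fun x : {ffun 'I_n -> 'Z_m} =>
                              `|f (x + basis_e m j) - f x| `^ p).
Proof.
have ln2_gt0 : 0 < ln 2 :> R by rewrite ln_gt0// ltr1n.
(* The modulus is always 4; dividing by [ln 2] covers n = 2, where the logarithm is smallest. The
   [t + 1] leaves room for an admissible type constant just above the infimum [Tp X p]. *)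
exists (4 / ln 2), (fun p t => 256 * (t + 1) `^ p) => p p12 X typeX n n2.
have /andP[p1 p2] := p12.
have n1 : 1 <= n%:R :> R by rewrite ler1n; exact: ltnW.
exists 4%N; split=> //; split=> //; split=> [|f].
  have a1 : 1 <= n%:R `^ (2 - p^-1) :> R.
    rewrite -[leLHS](powRr0 n%:R) ler_powR// subr_ge0.
    by apply: (@le_trans _ _ 1); [rewrite invf_le1//; lra|lra].
  have l1 : 1 <= ln n%:R / ln 2 :> R.
    by rewrite ler_pdivlMr// mul1r ler_ln ?posrE ?ltr0n ?ler_nat//; exact: ltnW.
  rewrite (_ : _ * _ = 4 * (n%:R `^ (2 - p^-1) * (ln n%:R / ln 2))); last by ring.
  by rewrite ler_peMr// mulr_ege1.
have [T typeT TTp] : exists2 T, rad_type_consts X p T & T < Tp X p + 1.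
  apply: inf_adherent => //; split=> //.
  by exists 0 => T [].
apply: (le_trans (enflo_type_Z4 f p12 typeT)); rewrite ler_wpM2r//.
  apply: sumr_ge0 => j _; rewrite /avg mulr_ge0 ?invr_ge0//.
  by apply: sumr_ge0 => x _; exact: powR_ge0.
have T0 : 0 <= T by case: typeT.
have TT : T `^ p <= (Tp X p + 1) `^ p.
  by rewrite ge0_ler_powR ?nnegrE//; lra.
(* The bound from [enflo_type_Z4] has no factor m^p; inserting one only enlarges it. *)
have m1 : 1 <= 4 `^ p :> R.
  by rewrite -[leLHS](powRr0 4) ler_powR ?ler1n//; lra.
have := powR_ge0 T p; nra.
Qed.
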